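(* Let $K$ be a field of characteristic zero, $\mathcal A=K[x,y,z]$, and let $\lambda=z$ and $P=\widetilde P+\frac{1}{r+2}z^{r+2}$ with $\widetilde P\in K[x,y]$, $r\in\mathbb N$, such that $P$ is weight homogeneous for some weights $\varpi_1,\varpi_2,\varpi_3$ of $x,y,z$, of degree $\varpi(P)$, and has an isolated singularity. Let $\pi$ be the generalized Jacobian Poisson structure on $\mathcal A$ given by $\lambda$ and the Casimir $P$, and let $\vec e_\varpi=(\varpi_1x,\varpi_2y,\varpi_3z)^t$. Then $$PH^1(\mathcal A,\pi)=\begin{cases}K[P](\nabla\lambda\times\nabla P)&\text{if }\varpi(P)\neq\varpi_1+\varpi_2,\\ K[P](\nabla\lambda\times\nabla P)\oplus K[P]\,\vec e_\varpi&\text{if }\varpi(P)=\varpi_1+\varpi_2,\end{cases}$$ meaning that in each case the submodule of $\mathcal A^3$ on the right-hand side is contained in $\ker\delta^1$ and maps isomorphically onto $PH^1(\mathcal A,\pi)=\ker\delta^1/\mathrm{Im}\,\delta^0$ under the quotient map.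
   Context: Weights are positive integers without common divisor; a nonzero polynomial is weight homogeneous of degree $d$ if it is a $K$-linear combination of monomials $x^ay^bz^c$ with $a\varpi_1+b\varpi_2+c\varpi_3=d$. $P$ has an isolated singularity if $\mathcal A_{sing}(P)=\mathcal A/\langle \partial P/\partial x,\partial P/\partial y,\partial P/\partial z\rangle$ is finite dimensional over $K$; the paper chooses a basis of $\mathcal A_{sing}(P)$ starting with $1$, so $\mathcal A_{sing}(P)\neq0$. $\mathbb N$ includes $0$. $\nabla$, $\mathrm{Div}$, $\times$, $\cdot$ are the formal gradient, divergence, vector product and scalar product. The Poisson structure is $\{f,g\}=\lambda\,\frac{df\wedge dg\wedge dP}{dx\wedge dy\wedge dz}$. With $\mathcal X^1(\mathcal A)\cong\mathcal A^3$ via $F_1\frac{\partial}{\partial x}+F_2\frac{\partial}{\partial y}+F_3\frac{\partial}{\partial z}\mapsto(F_1,F_2,F_3)$ and $\mathcal X^2(\mathcal A)\cong\mathcal A^3$ via $F_1\frac{\partial}{\partial y}\wedge\frac{\partial}{\partial z}+F_2\frac{\partial}{\partial z}\wedge\frac{\partial}{\partial x}+F_3\frac{\partial}{\partial x}\wedge\frac{\partial}{\partial y}\mapsto(F_1,F_2,F_3)$, the first Poisson coboundary operators are $\delta^0:\mathcal A\to\mathcal A^3$, $\delta^0(F)=-\lambda\nabla F\times\nabla P$, and $\delta^1:\mathcal A^3\to\mathcal A^3$, $\delta^1(\vec F)=-\lambda\nabla(\vec F\cdot\nabla P)+\left(\lambda\,\mathrm{Div}(\vec F)-\vec F\cdot\nabla\lambda\right)\nabla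 P$. *)

(* Defs.v *)
From HB Require Import structures.
From mathcomp Require Import all_boot all_order all_algebra.
From mathcomp Require Import generic_quotient ring_quotient mpoly.
From mathcomp Require boolp.
From mathcomp Require Import ring.

Set Implicit Arguments.
Unset Strict Implicit.
Unset Printing Implicit Defensive.

Import GRing.Theory.

Local Open Scope ring_scope.
Local Open Scope quotient_scope.

(* The library's Quotient.quot only carries a group structure. *)
Section ModuleQuotient.
Variables (K : pzRingType) (V : lmodType K) (I : submodClosed V).

Definition lquot_pred : {pred V} := I.
HB.instance Definition _ := GRing.isZmodClosed.Build V lquot_pred
  (GRing.submod_closedB (submodClosedP I)).

Definition lquot : Type := Quotient.quot lquot_pred.
HB.instance Definition _ := EqQuotient.on lquot.
HB.instance Definition _ := Choice.on lquot.
HB.instance Definition _ := ZmodQuotient.on lquot.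

Definition lquot_scale (a : K) : lquot -> lquot := lift_op1 lquot ( *:%R a).

Lemma pi_lquotE (x y : V) : (\pi_lquot x == \pi_lquot y) = (x - y \in I).
Proof. by rewrite -(Quotient.idealrBE lquot_pred). Qed.

Lemma pi_lquot_scale a : {morph \pi_lquot : x / a *: x >-> lquot_scale a x}.
Proof.
move=> x; rewrite /lquot_scale; unlock; apply/eqP.
by rewrite pi_lquotE -scalerBr rpredZ // -pi_lquotE reprK.
Qed.

Fact lquot_scaleA a b x :
  lquot_scale a (lquot_scale b x) = lquot_scale (a * b) x.
Proof. by rewrite -[x]reprK -!pi_lquot_scale scalerA. Qed.

Fact lquot_scale1 : left_id 1 lquot_scale.
Proof. by move=> x; rewrite -[x]reprK -pi_lquot_scale scale1r. Qed.

Fact lquot_scaleDr : right_distributive lquot_scale +%R.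
Proof.
move=> a x y; rewrite -[x]reprK -[y]reprK -!pi_lquot_scale.
by rewrite -!(raddfD (\pi_lquot)) -pi_lquot_scale scalerDr.
Qed.

Fact lquot_scaleDl x : {morph lquot_scale^~ x : a b / a + b}.
Proof.
by move=> a b; rewrite -[x]reprK -!pi_lquot_scale -raddfD scalerDl.
Qed.

HB.instance Definition _ := GRing.Zmodule_isLmodule.Build K lquot
  lquot_scaleA lquot_scale1 lquot_scaleDr lquot_scaleDl.

Fact pi_lquot_is_scalable : scalable \pi_lquot.
Proof. by move=> a x; rewrite pi_lquot_scale. Qed.

HB.instance Definition _ :=
  GRing.isScalable.Build K V lquot *:%R \pi_lquot pi_lquot_is_scalable.

End ModuleQuotient.

Definition finite_dim (K : fieldType) (V : lmodType K) : Prop :=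
  exists (n : nat) (b : 'I_n -> V),
    forall v : V, exists c : 'I_n -> K, v = \sum_i c i *: b i.

Definition ix : 'I_3 := @Ordinal 3 0 isT.
Definition iy : 'I_3 := @Ordinal 3 1 isT.
Definition iz : 'I_3 := @Ordinal 3 2 isT.

Fact I3P (i : 'I_3) : i = ix \/ i = iy \/ i = iz.
Proof.
by case: i => [[|[|[|//]]] ?];
  [left | right; left | right; right]; apply/val_inj.
Qed.

Fact sum3E (V : nmodType) (F : 'I_3 -> V) :
  \sum_(i < 3) F i = F ix + F iy + F iz.
Proof.
rewrite !big_ord_recl big_ord0 addr0 addrA.
by congr (F _ + F _ + F _); apply/val_inj.
Qed.

Section VectorCalculus.
Variable K : fieldType.
Local Notation A := {mpoly K[3]}.

(* Finite functions rather than 'cV[A]_3: the former are K-modules, the latter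
   only A-modules. *)
Definition vec3 : Type := {ffun 'I_3 -> A}.
HB.instance Definition _ := GRing.Lmodule.on vec3.

Implicit Types (f g : A) (F G : vec3).

Definition mkvec3 (f0 f1 f2 : A) : vec3 :=
  [ffun i : 'I_3 => [:: f0; f1; f2]`_i].

Definition mulv f F : vec3 := [ffun i => f * F i].

Definition grad f : vec3 := [ffun i => f^`M(i)].

Definition Div F : A := \sum_(i < 3) (F i)^`M(i).

Definition dotv F G : A := \sum_(i < 3) F i * G i.

Definition crossv F G : vec3 :=
  mkvec3 (F iy * G iz - F iz * G iy)
         (F iz * G ix - F ix * G iz)
         (F ix * G iy - F iy * G ix).

End VectorCalculus.

Section Singularity.
Variable K : fieldType.
Local Notation A := {mpoly K[3]}.
Implicit Types P f : A.

Definition jacobian_ideal P : {pred A} :=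
  fun f => boolp.asbool (exists F : vec3 K, f = dotv F (grad P)).

Fact jacobian_ideal_submod_closed P : submod_closed (jacobian_ideal P).
Proof.
split=> [|a f g].
  apply/boolp.asboolP; exists 0.
  by rewrite /dotv big1 // => i _; rewrite ffunE mul0r.
move=> /boolp.asboolP[F ->] /boolp.asboolP[G ->]; apply/boolp.asboolP.
exists (a *: F + G); rewrite /dotv scaler_sumr -big_split /=.
by apply: eq_bigr => i _; rewrite !ffunE mulrDl scalerAl.
Qed.

HB.instance Definition _ P :=
  GRing.isSubmodClosed.Build K A (jacobian_ideal P)
    (jacobian_ideal_submod_closed P).

Definition Asing P : lmodType K := lquot (jacobian_ideal P).

Definition isolated_singularity P : Prop := finite_dim (Asing P).

End Singularity.

Definition wdeg (w : 'I_3 -> nat) (m : 'X_{1..3}) : nat :=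
  (\sum_(i < 3) m i * w i)%N.

Fact wdeg0 w : wdeg w 0%MM = 0%N.
Proof. by rewrite /wdeg big1 // => i _; rewrite mnmE. Qed.

Fact wdegD w : {morph wdeg w : m1 m2 / (m1 + m2)%MM >-> (m1 + m2)%N}.
Proof.
move=> m1 m2; rewrite /wdeg -big_split /=.
by apply: eq_bigr => i _; rewrite mnmDE mulnDl.
Qed.

HB.instance Definition _ w := isMeasure.Build 3 (wdeg w) (wdeg0 w) (wdegD w).

Definition is_weight (w : 'I_3 -> nat) : Prop :=
  (forall i, 0 < w i)%N /\ \big[gcdn/0%N]_(i < 3) w i = 1%N.

Definition weight_homogeneous (K : fieldType) (w : 'I_3 -> nat) (d : nat)
    (P : {mpoly K[3]}) : Prop :=
  P != 0 /\ P \is ishomog1 d (wdeg w).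

Definition euler_field (K : fieldType) (w : 'I_3 -> nat) : vec3 K :=
  [ffun i => (w i)%:R *: 'X_i].

Section FirstPoissonCohomology.
Variables (K : fieldType) (lambda P : {mpoly K[3]}).
Local Notation A := {mpoly K[3]}.

(* First coboundary operators of the Poisson bracket
   {f, g} = lambda * det (grad f, grad g, grad P); a bivector field
   F0 d_y^d_z + F1 d_z^d_x + F2 d_x^d_y is identified with (F0, F1, F2). *)
Definition delta0 (f : A) : vec3 K :=
  - mulv lambda (crossv (grad f) (grad P)).

Definition delta1 (F : vec3 K) : vec3 K :=
  - mulv lambda (grad (dotv F (grad P)))
  + mulv (lambda * Div F - dotv F (grad lambda)) (grad P).

Fact delta0_is_linear : linear delta0.
Proof.
move=> a f g; apply/ffunP=> i; rewrite /delta0 !ffunE.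
by case: i => [[|[|[|//]]] ?] /=; rewrite !mderivD !mderivZ -!mul_mpolyC;
  ring.
Qed.

HB.instance Definition _ := GRing.isLinear.Build K A (vec3 K) *:%R delta0
  delta0_is_linear.

Fact delta1_is_linear : linear delta1.
Proof.
move=> a F G; apply/ffunP=> i; rewrite /delta1 !ffunE /dotv /Div.
rewrite !sum3E !ffunE /= !mderivD !mderivM !mderivD !mderivZ.
rewrite -!mul_mpolyC; ring.
Qed.

HB.instance Definition _ := GRing.isLinear.Build K (vec3 K) (vec3 K) *:%R delta1
  delta1_is_linear.

Fact delta1_delta0 (f : A) : delta1 (delta0 f) = 0.
Proof.
apply/ffunP=> i; rewrite /delta1 !ffunE /dotv /Div !sum3E !ffunE /=.
rewrite !(mderivN, mderivM, mderivB, mderivD).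
have [->|[->|->]] := I3P i;
  rewrite !(@mderiv_comm _ _ iy ix, @mderiv_comm _ _ iz ix,
            @mderiv_comm _ _ iz iy); ring.
Qed.

Definition ker_delta1 : {pred vec3 K} := fun F => delta1 F == 0.

Fact ker_delta1_submod_closed : submod_closed ker_delta1.
Proof.
split=> [|a F G]; rewrite !unfold_in ?linear0 //.
by move=> /eqP F0 /eqP G0; rewrite linearP /= F0 G0 scaler0 addr0.
Qed.

HB.instance Definition _ := GRing.isSubmodClosed.Build K (vec3 K) ker_delta1
  ker_delta1_submod_closed.

Record Z1 := MkZ1 { z1val :> vec3 K; _ : z1val \in ker_delta1 }.

HB.instance Definition _ := [isSub for z1val].
HB.instance Definition _ := [Choice of Z1 by <:].
HB.instance Definition _ := [SubChoice_isSubLmodule of Z1 by <:].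

(* Im delta0, as a submodule of Z1; it lies in Z1 by delta1_delta0. *)
Definition B1 : {pred Z1} :=
  fun F => boolp.asbool (exists f : A, val F = delta0 f).

Fact B1_submod_closed : submod_closed B1.
Proof.
split=> [|a F G].
  by apply/boolp.asboolP; exists 0; rewrite !linear0.
move=> /boolp.asboolP[f Ff] /boolp.asboolP[g Gg]; apply/boolp.asboolP.
by exists (a *: f + g); rewrite !linearP /= Ff Gg.
Qed.

HB.instance Definition _ := GRing.isSubmodClosed.Build K Z1 B1 B1_submod_closed.

Definition PH1 : lmodType K := lquot B1.

(* The quotient map is linear, and for a submodule S the last two clauses say
   that its restriction to S is bijective. *)
Definition maps_isomorphically_onto_PH1 (S : vec3 K -> Prop) : Prop :=
  [/\ forall F : vec3 K, S F -> delta1 F = 0,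
      forall F G : Z1, S (val F) -> S (val G) ->
        \pi_(lquot B1) F = \pi_(lquot B1) G -> F = G
    & forall c : PH1, exists2 F : Z1, S (val F) & \pi_(lquot B1) F = c].

End FirstPoissonCohomology.

Section Submodules.
Variable K : fieldType.

(* K[P] v; [horner_alg P] is evaluation K[T] -> K[x,y,z] at P *)
Definition KP_span (P : {mpoly K[3]}) (v : vec3 K) : vec3 K -> Prop :=
  fun F => exists phi : {poly K}, F = mulv (horner_alg P phi) v.

Definition sum_set (S T : vec3 K -> Prop) : vec3 K -> Prop :=
  fun F => exists G H : vec3 K, [/\ S G, T H & F = G + H].

Definition sum_is_direct (S T : vec3 K -> Prop) : Prop :=
  forall F : vec3 K, S F -> T F -> F = 0.

End Submodules.

(* Main.v *)
(* Write p for the part of P in K[x, y], and px, py for its derivatives.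
   Finite-dimensionality gives nonzero polynomials s(x), t(y) in the ideal
   (px, py), whence (px, py) is a regular sequence.
   For a cocycle F put G = F . grad P.  The cocycle equation reads
   z grad G = (z Div F - F_z) grad P; since px is prime to z this gives
   grad G = h grad P, so G is a polynomial in P, without constant term because
   P lies in the proper Jacobian ideal.  Euler's formula then yields psi(P) with
   (F - psi(P) e) . grad P = 0, and exactness of the Koszul complex modulo
   z^(r+2) gives F = psi(P) e + k u + z (grad P x H).  The cocycle equation for
   this F, reduced modulo z, says that (d - w1 - w2) psi(p) is a bracket
   {p, k(x, y, 0)}; such a bracket is never a nonzero polynomial in p, so
   psi = 0 or d = w1 + w2, and k(x, y, 0) = gamma(p).  What is left is
   grad P . curl H = 0, which forces H = grad f + g grad P, hence
   F = gamma(P) u + psi(P) e + delta0 f. *)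
Require Import Defs.
From HB Require Import structures.
From mathcomp Require Import all_boot all_order all_algebra.
From mathcomp Require Import mpoly ring zify.
From mathcomp Require Import generic_quotient ring_quotient.
From mathcomp Require boolp.

Set Implicit Arguments.
Unset Strict Implicit.
Unset Printing Implicit Defensive.

Import Order.TTheory GRing.Theory.

Local Open Scope ring_scope.
Local Open Scope quotient_scope.

(** * Derivatives and antiderivatives of polynomials, with degree bounds *)

Section Mpoly.
Variables (K : fieldType) (n : nat).
Implicit Types (f g h : {mpoly K[n]}) (m : 'X_{1..n}) (i j : 'I_n).

Lemma mderivXU i j : ('X_j : {mpoly K[n]})^`M(i) = (i == j)%:R.
Proof.
rewrite mderivX mnm1E eq_sym; case: eqP => [->|_]; last by rewrite scale0r.
have -> : (U_(j) - U_(j) = 0 :> 'X_{1..n})%MM.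
  by apply/mnmP => k; rewrite mnmBE subnn mnm0E.
by rewrite mpolyX0 scale1r.
Qed.

Lemma msize_leP f N :
  reflect (forall m, (N <= mdeg m)%N -> f@_m = 0) (msize f <= N)%N.
Proof.
apply: (iffP idP) => [fN m Nm|fN].
  by apply: memN_msupp_eq0; apply: msize_mdeg_ge; apply: leq_trans Nm.
rewrite msizeE; apply/bigmax_leqP_seq => m mf _; rewrite ltnNge.
by apply: contraTN mf => /fN /eqP; rewrite mcoeff_eq0.
Qed.

Lemma msizeD_le_max f g N :
  (msize f <= N)%N -> (msize g <= N)%N -> (msize (f + g) <= N)%N.
Proof.
move=> fN gN; apply: leq_trans (msizeD_le _ _) _.
by rewrite geq_max fN gN.
Qed.

Lemma msize_mderiv i f N : (msize f <= N)%N -> (msize f^`M(i) <= N.-1)%N.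
Proof.
move=> /msize_leP fN; apply/msize_leP => m Nm.
by rewrite mcoeff_mderiv fN ?mul0rn // mdegD mdeg1; lia.
Qed.

(* [msizeM] and [mleadM] are stated for the ring underlying an idomainType;
   these are their instances at the ring underlying a fieldType, which is not
   syntactically the same. *)
Lemma msizeMf f g :
  f != 0 -> g != 0 -> msize (f * g) = (msize f + msize g).-1.
Proof. exact: msizeM. Qed.

Lemma mleadMf f g : f != 0 -> g != 0 -> mlead (f * g) = (mlead f + mlead g)%MM.
Proof. exact: mleadM. Qed.

Lemma msize_mulX i f N : (msize f <= N.-1)%N -> (msize ('X_i * f) <= N)%N.
Proof.
have [->|f0 fN] := eqVneq f 0; first by rewrite mulr0 msize0.
have: (0 < msize f)%N by rewrite lt0n msize_poly_eq0.
rewrite msizeMf ?msizeX ?mdeg1 //; last first.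
  by rewrite -msize_poly_eq0 msizeX mdeg1.
by lia.
Qed.

Hypothesis charK0 : [pchar K] =i pred0.

Lemma natrS_neq0 k : k.+1%:R != 0 :> K.
Proof. by move/pcharf0P: charK0 => ->. Qed.

(* The mean of [f] along the [i]-th coordinate:
   [int_0^1 f (.., t * x_i, ..) dt]. *)
Definition mmean i f : {mpoly K[n]} :=
  \sum_(m <- msupp f) (f@_m / (m i).+1%:R) *: 'X_[m].

Lemma mcoeff_mmean i f m : (mmean i f)@_m = f@_m / (m i).+1%:R.
Proof.
rewrite /mmean raddf_sum /=.
have [mf|mf] := boolP (m \in msupp f).
  rewrite (bigD1_seq m) ?msupp_uniq //= mcoeffZ mcoeffX eqxx mulr1.
  rewrite big1 ?addr0 // => k /negPf km.
  by rewrite mcoeffZ mcoeffX km mulr0.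
rewrite (memN_msupp_eq0 mf) mul0r big_seq big1 // => k kf.
rewrite mcoeffZ mcoeffX; case: eqP => [km|]; last by rewrite mulr0.
by move: mf; rewrite -km kf.
Qed.

Lemma msize_mmean i f N : (msize f <= N)%N -> (msize (mmean i f) <= N)%N.
Proof.
move=> /msize_leP fN; apply/msize_leP => m Nm.
by rewrite mcoeff_mmean fN ?mul0r.
Qed.

Lemma mcoeff_mulX i f m : ('X_i * f)@_(m + U_(i)) = f@_m.
Proof. by rewrite mulrC addmC mcoeffMX. Qed.

Lemma mderiv_mulX_mmean i f : ('X_i * mmean i f)^`M(i) = f.
Proof.
apply/mpolyP => m; rewrite mcoeff_mderiv mcoeff_mulX mcoeff_mmean.
by rewrite -[LHS]mulr_natr divfK ?natrS_neq0.
Qed.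

Lemma mderiv_mmean i j f : i != j -> (mmean i f)^`M(j) = mmean i f^`M(j).
Proof.
move=> ij; apply/mpolyP => m.
rewrite mcoeff_mderiv !mcoeff_mmean mcoeff_mderiv mnmDE mnm1E.
by rewrite [j == i]eq_sym (negPf ij) addn0 mulrnAl.
Qed.

Lemma mderiv_mulX_eq0 i f : ('X_i * f)^`M(i) = 0 -> f = 0.
Proof.
move=> f0; apply/mpolyP => m; move/(congr1 (mcoeff m))/eqP: f0.
rewrite mcoeff_mderiv mcoeff_mulX mcoeff0 -[X in X == 0]mulr_natr mulf_eq0.
by rewrite (negPf (natrS_neq0 _)) orbF => /eqP.
Qed.

(** The product of ['X_i] and the mean of the i-th derivative is the antiderivative of that
    derivative vanishing at x_i = 0, so [f0] is [f] at x_i = 0. *)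
Lemma split_var i f : exists f0 f1, [/\ f = f0 + 'X_i * f1, f0^`M(i) = 0
  & forall N, (msize f <= N)%N -> (msize f0 <= N)%N /\ (msize f1 <= N.-1)%N].
Proof.
set f1 := mmean i f^`M(i).
have f1N N : (msize f <= N)%N -> (msize f1 <= N.-1)%N.
  by move=> fN; apply/msize_mmean/msize_mderiv.
exists (f - 'X_i * f1), f1; split=> [||N fN]; first by rewrite subrK.
  by rewrite mderivB mderiv_mulX_mmean subrr.
split; last exact: f1N.
by apply: msizeD_le_max => //; rewrite msizeN; apply/msize_mulX/f1N.
Qed.

Lemma mderiv_eq0_const f : (forall i, f^`M(i) = 0) -> f = (f@_0)%:MP.
Proof.
move=> df; apply/mpolyP => m; rewrite mcoeffC.
have [->|m0] := eqVneq m 0%MM; first by rewrite mulr1.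
rewrite mulr0.
have [i mi] : exists i, (0 < m i)%N.
  apply/existsP; apply: contraNT m0 => /existsPn m0; apply/eqP/mnmP => i.
  by rewrite mnm0E; apply/eqP; have := m0 i; rewrite -leqNgt leqn0.
have := df i => /(congr1 (mcoeff (m - U_(i))%MM))/eqP.
rewrite mcoeff_mderiv mcoeff0 -[X in X == 0]mulr_natr mulf_eq0.
rewrite (negPf (natrS_neq0 _)) orbF.
by rewrite submK ?lep1mP -?lt0n // => /eqP.
Qed.

End Mpoly.

(** * Divisibility by comparison of leading monomials *)

Section Division.
Variables (K : fieldType) (n : nat).
Hypothesis charK0 : [pchar K] =i pred0.
Implicit Types (f g s t : {mpoly K[n]}) (i : 'I_n).

Lemma mlead_mderiv_eq0 i f : f^`M(i) = 0 -> mlead f i = 0%N.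
Proof.
have [->|f0 df] := eqVneq f 0; first by rewrite mlead0 mnm0E.
apply/eqP; rewrite -leqn0 leqNgt; apply/negP => fi.
have := congr1 (mcoeff (mlead f - U_(i))%MM) df.
rewrite mcoeff_mderiv mcoeff0 submK ?lep1mP -?lt0n // => /eqP.
rewrite -[X in X == 0]mulr_natr mulf_eq0 (negPf (natrS_neq0 charK0 _)) orbF.
by rewrite mleadc_eq0 (negPf f0).
Qed.

(* The leading monomial of [f] is divisible by that of [s], so [s] can be
   divided into [f] without assuming unique factorization. *)
Lemma dvd_of_disjoint_mlead s t f g : s != 0 -> t != 0 ->
  (forall i, mlead s i = 0%N \/ mlead t i = 0%N) ->
  t * f = s * g -> exists q, f = s * q.
Proof.
move=> s0 t0 st; elim/mleadrect: f g => f IH g tf_sg.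
have [->|f0] := eqVneq f 0; first by exists 0; rewrite mulr0.
have g0 : g != 0.
  by apply: contra_neq (mulf_neq0 t0 f0) => g0; rewrite tf_sg g0 mulr0.
have sf : (mlead s <= mlead f)%MM.
  apply/mnm_lepP => i; have /mnmP/(_ i) := congr1 (@mlead _ _) tf_sg.
  by rewrite !mleadMf // !mnmDE; case: (st i) => ->; lia.
set m := (mlead f - mlead s)%MM.
set c := mleadc f / mleadc s.
have c0 : c != 0 by rewrite mulf_neq0 ?invr_eq0 ?mleadc_eq0.
set h : {mpoly K[n]} := c *: 'X_[m].
have h0 : h != 0.
  apply/eqP => /(congr1 (mcoeff m))/eqP.
  by rewrite mcoeffZ mcoeffX eqxx mulr1 mcoeff0 (negPf c0).
have leadh : mlead (s * h) = mlead f.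
  by rewrite mleadMf // /h mleadZ // mleadXm addmC submK.
have [fh|fh] := eqVneq (f - s * h) 0.
  by exists h; apply/eqP; rewrite -subr_eq0 fh.
have [] := IH (f - s * h) _ (g - t * h).
- rewrite lt_neqAle; apply/andP; split.
    apply/eqP => lead_eq; move: fh; rewrite -mleadc_eq0 lead_eq mcoeffB.
    have -> : (s * h)@_(mlead f) = mleadc f; last by rewrite subrr eqxx.
    rewrite -[in LHS]leadh mleadMf // mleadcM /h mleadZ // mleadXm.
    by rewrite mcoeffZ mcoeffX eqxx mulr1 mulrC divfK ?mleadc_eq0.
  by apply: le_trans (mleadB_le _ _) _; rewrite leadh leUx lexx.
- by rewrite !mulrBr tf_sg; ring.
by move=> q fq; exists (q + h); rewrite mulrDr -fq subrK.
Qed.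

End Division.

(** * Eliminants in one variable inside the Jacobian ideal *)

Section JacobianIdeal.
Variable K : fieldType.
Local Notation A := {mpoly K[3]}.
Implicit Types (P f : A) (i j : 'I_3).

(** The quotient is spanned by n elements, so the first n + 1 powers of ['X_i] are linearly
    dependent in it; a dependency is the desired [s]. *)
Lemma isolated_singularity_var P i : isolated_singularity P ->
  exists s : A, [/\ s != 0, forall j, j != i -> s^`M(j) = 0
    & exists F : vec3 K, s = dotv F (grad P)].
Proof.
move=> [n [b span_b]].
pose X (k : 'I_n.+1) : A := 'X_[U_(i) *+ k].
have [c cE] : exists c : 'I_n.+1 -> 'I_n -> K,
    forall k, \pi_(lquot (jacobian_ideal P)) (X k) = \sum_l c k l *: b l.
  exact: (fin_all_exists (fun k => span_b (\pi_(lquot _) (X k)))).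
pose C := \matrix_(k, l) c k l.
have [v vC v0] : exists2 v : 'rV_n.+1, v *m C = 0 & v != 0.
  have : kermx C != 0.
    by rewrite kermx_eq0 /row_free neq_ltn (leq_ltn_trans (rank_leq_col C)).
  by case/rowV0Pn => v /sub_kermxP vC v0; exists v.
pose s := \sum_k v 0 k *: X k.
exists s; split.
- apply: contra_neq v0 => s0; apply/rowP => k; rewrite mxE.
  have := congr1 (mcoeff (U_(i) *+ k)%MM) s0.
  rewrite mcoeff0 raddf_sum (bigD1 k) //= mcoeffZ mcoeffX eqxx mulr1 big1.
    by rewrite addr0.
  move=> l lk; rewrite mcoeffZ mcoeffX; case: eqP => [/mnmP/(_ i)|].
    by rewrite !mulmnE mnm1E eqxx !mul1n => /val_inj/eqP; rewrite (negPf lk).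
  by rewrite mulr0.
- move=> j ji; rewrite raddf_sum big1 // => k _ /=.
  rewrite mderivZ mderivX mulmnE mnm1E eq_sym (negPf ji) mul0n.
  by rewrite scale0r scaler0.
have : s - 0 \in jacobian_ideal P.
  rewrite -pi_lquotE raddf_sum raddf0 /=; apply/eqP.
  under eq_bigr => k _ do rewrite linearZ /= cE scaler_sumr.
  rewrite exchange_big /= big1 // => l _.
  under eq_bigr => k _ do rewrite scalerA.
  rewrite -scaler_suml; have /rowP/(_ l) := vC; rewrite !mxE => vCl.
  under eq_bigr => k _ do rewrite -[c k l](mxE matrix_key (fun k l => c k l)).
  by rewrite vCl scale0r.
by rewrite subr0 => /boolp.asboolP.
Qed.

End JacobianIdeal.

(** * Regularity of the pair of partial derivatives of p *)

Section Potential.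
Variable K : fieldType.
Hypothesis charK0 : [pchar K] =i pred0.
Local Notation A := {mpoly K[3]}.
Local Notation z := ('X_iz : A).
Implicit Types f g h a b c : A.

Lemma mderivXn i f k :
  (f ^+ k.+1)^`M(i) = k.+1%:R * (f ^+ k * f^`M(i)).
Proof.
elim: k => [|k IH]; first by rewrite expr1 expr0 !mul1r.
by rewrite exprS mderivM IH [f ^+ k.+1]exprS -[k.+2%:R]natr1; ring.
Qed.

(** The sum of K[x, y] and the ideal (z) is direct; this is how equations are reduced modulo z. *)
Lemma zfree_eq0 f g h :
  f^`M(iz) = 0 -> g^`M(iz) = 0 -> f = g + z * h -> f = g /\ h = 0.
Proof.
move=> df dg fE; have h0 : h = 0.
  apply: (mderiv_mulX_eq0 charK0 (i := iz)).
  by move: df; rewrite fE mderivD dg add0r.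
by rewrite fE h0 mulr0 addr0.
Qed.

Variables (r : nat) (p : A).
Hypothesis dzp : p^`M(iz) = 0.
Local Notation P := (p + (r.+2)%:R^-1 *: z ^+ r.+2).
Local Notation px := (p^`M(ix)).
Local Notation py := (p^`M(iy)).

Lemma potential_dx : P^`M(ix) = px.
Proof. by rewrite mderivD mderivZ mderivXn mderivXU !mulr0 scaler0 addr0. Qed.

Lemma potential_dy : P^`M(iy) = py.
Proof. by rewrite mderivD mderivZ mderivXn mderivXU !mulr0 scaler0 addr0. Qed.

Lemma potential_dz : P^`M(iz) = z ^+ r.+1.
Proof.
rewrite mderivD dzp add0r mderivZ mderivXn mderivXU eqxx mulr1 mulr_natl.
by rewrite -[z ^+ _ *+ _]scaler_nat scalerA mulVf ?natrS_neq0 ?scale1r.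
Qed.

Lemma dz_px : px^`M(iz) = 0.
Proof. by rewrite mderiv_comm dzp mderiv0. Qed.

Lemma dz_py : py^`M(iz) = 0.
Proof. by rewrite mderiv_comm dzp mderiv0. Qed.

Lemma jacobian_idealE (F : vec3 K) :
  dotv F (grad P) = F ix * px + F iy * py + F iz * z ^+ r.+1.
Proof.
by rewrite /dotv sum3E !ffunE potential_dx potential_dy potential_dz.
Qed.

Hypothesis isoP : isolated_singularity P.
Hypothesis properP : ~ exists F : vec3 K, 1 = dotv F (grad P).

Lemma jacobian_proper a b c : 1 <> a * px + b * py + c * z ^+ r.+1.
Proof.
move=> abc; apply: properP; exists (mkvec3 a b c).
by rewrite jacobian_idealE !ffunE.
Qed.

(** Setting z = 0 in an eliminant removes its term in z^(r+1), whose exponent is positive, and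
    leaves [s] unchanged. *)
Lemma isolated_singularity_xy i : i != iz -> exists s : A,
  [/\ s != 0, forall j, j != i -> s^`M(j) = 0
    & exists a b, s = a * px + b * py].
Proof.
move=> iNz; have [s [s0 ds [F sE]]] := isolated_singularity_var i isoP.
exists s; split=> //; move: sE; rewrite jacobian_idealE.
have [a0 [a1 [-> da _]]] := split_var charK0 iz (F ix).
have [b0 [b1 [-> db _]]] := split_var charK0 iz (F iy) => sE.
exists a0, b0.
apply: (proj1 (@zfree_eq0 _ _ (a1 * px + b1 * py + F iz * z ^+ r) _ _ _)).
- by apply: ds; rewrite eq_sym.
- by rewrite mderivD !mderivM da db dz_px dz_py; ring.
by rewrite sE exprS; ring.
Qed.

(** If [px] were zero, s(x) and t(y) would both be multiples of [py]; then s would divide its own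
    cofactor and [py] would be a unit. *)
Lemma px_neq0 : px != 0.
Proof.
apply/eqP => px0.
have [s [s0 ds [a [b]]]] := isolated_singularity_xy (isT : ix != iz).
have [t [t0 dt [a' [b']]]] := isolated_singularity_xy (isT : iy != iz).
rewrite px0 !mulr0 !add0r => tE sE.
have [] := @dvd_of_disjoint_mlead _ _ s t b b' s0 t0.
- move=> i; have [ii|ii] := eqVneq i ix.
    by right; apply: (mlead_mderiv_eq0 charK0); apply: dt; rewrite ii.
  by left; apply: (mlead_mderiv_eq0 charK0); apply: ds.
- by rewrite sE tE; ring.
move=> q bq; apply: (@jacobian_proper 0 q 0).
apply: (mulfI s0); rewrite mulr1 !(mul0r, mulr0, add0r, addr0).
by rewrite {1}sE bq mulrA.
Qed.

(** A nonzero constant would generate the unit ideal. Division by [px] therefore lowers degrees,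
    which drives the later inductions. *)
Lemma msize_px : (1 < msize px)%N.
Proof.
rewrite ltnNge; apply/negP => /msize1_polyC pxE.
have c0 : px@_0 != 0.
  by apply: contraNneq px_neq0 => c0; rewrite pxE c0 mpolyC0.
apply: (@jacobian_proper (px@_0)^-1%:MP 0 0).
by rewrite {2}pxE -mpolyCM mulVf // !mul0r !addr0.
Qed.

(* With s(x) and t(y) nonzero in (px, py), the relation [px * a = py * b] makes
   both [s * b] and [t * b] multiples of [px]. *)
Lemma px_py_regular a b :
  px * a = py * b -> exists k, a = py * k /\ b = px * k.
Proof.
move=> ab.
have [s [s0 ds [c1 [c2 sE]]]] := isolated_singularity_xy (isT : ix != iz).
have [t [t0 dt [e1 [e2 tE]]]] := isolated_singularity_xy (isT : iy != iz).
have sb : s * b = px * (c1 * b + c2 * a).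
  have -> : s * b = px * (c1 * b) + c2 * (py * b) by rewrite sE; ring.
  by rewrite -ab; ring.
have tb : t * b = px * (e1 * b + e2 * a).
  have -> : t * b = px * (e1 * b) + e2 * (py * b) by rewrite tE; ring.
  by rewrite -ab; ring.
have [] := @dvd_of_disjoint_mlead _ _ s t (c1 * b + c2 * a) (e1 * b + e2 * a).
- by [].
- by [].
- move=> i; have [ii|ii] := eqVneq i ix.
    by right; apply: (mlead_mderiv_eq0 charK0); apply: dt; rewrite ii.
  by left; apply: (mlead_mderiv_eq0 charK0); apply: ds.
- by apply: (mulfI px_neq0); rewrite !(mulrCA px) -sb -tb mulrCA.
move=> k kE; exists k.
have bk : b = px * k by apply: (mulfI s0); rewrite sb kE; ring.
by split=> //; apply: (mulfI px_neq0); rewrite ab bk mulrCA.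
Qed.

End Potential.

(* [t = u] follows from the equations [li = ri]; the multipliers [ci] make the
   remaining goal a ring identity. *)
Section LinearCombination.
Variable R : comPzRingType.
Implicit Types (l r c t u : R).

Lemma lincomb1 c1 l1 r1 t u : l1 = r1 -> t - u = c1 * (l1 - r1) -> t = u.
Proof.
by move=> -> /eqP; rewrite subrr mulr0 subr_eq0 => /eqP.
Qed.

Lemma lincomb2 c1 c2 l1 r1 l2 r2 t u : l1 = r1 -> l2 = r2 ->
  t - u = c1 * (l1 - r1) + c2 * (l2 - r2) -> t = u.
Proof.
by move=> -> -> /eqP; rewrite !subrr !mulr0 addr0 subr_eq0 => /eqP.
Qed.

Lemma lincomb3 c1 c2 c3 l1 r1 l2 r2 l3 r3 t u :
  l1 = r1 -> l2 = r2 -> l3 = r3 ->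
  t - u = c1 * (l1 - r1) + c2 * (l2 - r2) + c3 * (l3 - r3) -> t = u.
Proof.
by move=> -> -> -> /eqP; rewrite !subrr !mulr0 !addr0 subr_eq0 => /eqP.
Qed.

Lemma lincomb4 c1 c2 c3 c4 l1 r1 l2 r2 l3 r3 l4 r4 t u :
  l1 = r1 -> l2 = r2 -> l3 = r3 -> l4 = r4 ->
  t - u = c1 * (l1 - r1) + c2 * (l2 - r2) + c3 * (l3 - r3) + c4 * (l4 - r4) ->
  t = u.
Proof.
by move=> -> -> -> -> /eqP; rewrite !subrr !mulr0 !addr0 subr_eq0 => /eqP.
Qed.

End LinearCombination.

(** * Univariate polynomials evaluated at one element *)

Section PolynomialsInOneElement.
Variables (K : fieldType) (n : nat).
Implicit Types (Q : {mpoly K[n]}) (phi : {poly K}).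

Lemma mderiv_horner_alg i Q phi :
  (horner_alg Q phi)^`M(i) = horner_alg Q phi^`() * Q^`M(i).
Proof.
elim/poly_ind: phi => [|phi c IH]; first by rewrite deriv0 !raddf0 mul0r.
rewrite derivMXaddC !rmorphD !rmorphM /= horner_algC horner_algX.
rewrite mderivD mderivM IH mderivZ -mpolyC1 mderivC scaler0 addr0.
by ring.
Qed.

Lemma poly_split0 phi : exists c rho, phi = c%:P + 'X * rho.
Proof.
elim/poly_ind: phi => [|rho c _]; first by exists 0, 0; rewrite mulr0 addr0.
by exists c, rho; rewrite addrC mulrC.
Qed.

Lemma horner_alg_split0 Q c rho :
  horner_alg Q (c%:P + 'X * rho) = c%:MP + Q * horner_alg Q rho.
Proof.
rewrite rmorphD rmorphM /= horner_algC horner_algX.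
by rewrite -mpolyC1 -mul_mpolyC mulr1.
Qed.

Lemma horner_alg_natXM Q d rho :
  horner_alg Q (d%:R *: ('X * rho)) = d%:R * Q * horner_alg Q rho.
Proof. by rewrite linearZ /= rmorphM /= horner_algX scaler_nat mulrA. Qed.

(** As d is invertible, the relation puts [Q] in the ideal (f, g, h); the constant term of [phi]
    then lies there too, and it vanishes because the ideal is proper. *)
Lemma horner_alg_proper_ideal Q f g h e1 e2 e3 a b c d phi : d%:R != 0 :> K ->
  (forall a b c, 1 <> a * f + b * g + c * h) ->
  e1 * f + e2 * g + e3 * h = d%:R * Q ->
  horner_alg Q phi = a * f + b * g + c * h ->
  exists rho, phi = d%:R *: ('X * rho).
Proof.
move=> d0 proper QE; have [c0 [rho ->]] := poly_split0 phi.
rewrite horner_alg_split0; set rQ := horner_alg Q rho => phiE.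
have [c0E|c0N0] := eqVneq c0 0.
  exists (d%:R^-1 *: rho); rewrite c0E add0r scalerAr scalerA divff //.
  by rewrite scale1r.
pose ci : {mpoly K[n]} := (c0^-1)%:MP; pose di : {mpoly K[n]} := (d%:R^-1)%:MP.
have E1 : ci * c0%:MP = 1 by rewrite -mpolyCM mulVf.
have E2 : di * d%:R = 1.
  by rewrite -[d%:R](rmorph_nat (@mpolyC n K)) -mpolyCM mulVf.
exfalso; apply: (proper (ci * a - ci * rQ * di * e1)
  (ci * b - ci * rQ * di * e2) (ci * c - ci * rQ * di * e3)).
apply: (lincomb4 (c1 := -1) (c2 := ci * rQ * Q) (c3 := ci * rQ * di)
                 (c4 := ci) E1 E2 QE phiE).
ring.
Qed.

(** This allows the passage from polynomials in P to polynomials in p modulo z. *)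
Lemma horner_alg_congr Q f phi i : exists g,
  horner_alg (Q + 'X_i * f) phi = horner_alg Q phi + 'X_i * g.
Proof.
elim/poly_ind: phi => [|phi c [g IH]].
  by exists 0; rewrite !raddf0 mulr0 addr0.
exists (g * Q + horner_alg Q phi * f + 'X_i * g * f).
rewrite !rmorphD !rmorphM /= !horner_algC !horner_algX IH; ring.
Qed.

Hypothesis charK0 : [pchar K] =i pred0.

Lemma natr_inj_char0 k l : k%:R = l%:R :> K -> k = l.
Proof.
wlog kl : k l / (k <= l)%N => [IH|/eqP].
  by case: (leqP k l) => [/IH//|/ltnW/IH lk /esym/lk].
rewrite eq_sym -subr_eq0 -natrB //.
case E : (l - k)%N => [|e]; last by rewrite (negPf (natrS_neq0 charK0 _)).
by move: E; lia.
Qed.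

Lemma poly_antiderivative phi : exists psi : {poly K}, psi^`() = phi.
Proof.
exists (\poly_(k < (size phi).+1) (phi`_k.-1 / k%:R)).
apply/polyP => k; rewrite coef_deriv coef_poly ltnS /=.
case: ltnP => [_|/(nth_default 0) ->]; last by rewrite mul0rn.
by rewrite -[LHS]mulr_natr divfK ?natrS_neq0.
Qed.

End PolynomialsInOneElement.

(** * Exactness for a potential with regular partial derivatives *)

Section RegularPotential.
Variable K : fieldType.
Hypothesis charK0 : [pchar K] =i pred0.
Local Notation A := {mpoly K[3]}.
Local Notation x := ('X_ix : A).
Local Notation y := ('X_iy : A).
Local Notation z := ('X_iz : A).
Implicit Types a b c f g h k Q : A.

Variable p : A.
Local Notation px := (p^`M(ix)).
Local Notation py := (p^`M(iy)).
Hypothesis dzp : p^`M(iz) = 0.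
Hypothesis px_neq0 : px != 0.
Hypothesis msize_px : (1 < msize px)%N.
Hypothesis regular : forall a b,
  px * a = py * b -> exists k, a = py * k /\ b = px * k.

Lemma msize_mul_px k N : (msize (px * k) <= N)%N -> (msize k <= N.-1)%N.
Proof.
have [->|k0] := eqVneq k 0; first by rewrite msize0.
by rewrite msizeMf //; move: msize_px; lia.
Qed.

(** Equality of mixed partials makes the gradient of [h] collinear with that of [Q] as well. Since
    [px * h] is a derivative of [f], [h] has smaller degree, so by induction it is phi(Q);
    integrating [phi] gives [f] up to a constant. *)
Lemma grad_collinear_horner_alg Q f h : Q^`M(ix) = px -> Q^`M(iy) = py ->
  (forall i, f^`M(i) = h * Q^`M(i)) -> exists phi, f = horner_alg Q phi.
Proof.
move=> Qx Qy; have [N] := ubnP (msize f).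
elim: N f h => // N IH f h; rewrite ltnS => fN df.
have [k dh] : exists k, forall i, h^`M(i) = k * Q^`M(i).
  have hxy : px * h^`M(iy) = py * h^`M(ix).
    have := mderiv_comm ix iy f; rewrite !df !mderivM Qx Qy.
    by rewrite (mderiv_comm iy ix p) => /addIr E; rewrite [LHS]mulrC E mulrC.
  have [k [hy hx]] := regular hxy; exists k.
  suff hz : h^`M(iz) = k * Q^`M(iz).
    move=> i; have [->|[->|->]] := I3P i;
      by rewrite ?Qx ?Qy ?hx ?hy ?hz // mulrC.
  have := mderiv_comm ix iz f; rewrite !df !mderivM.
  rewrite (mderiv_comm iz ix Q) => /addIr; rewrite hx Qx => E.
  by apply: (mulfI px_neq0); rewrite [LHS]mulrC E; ring.
have [phi hE] : exists phi, h = horner_alg Q phi.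
  have [->|h0] := eqVneq h 0; first by exists 0; rewrite raddf0.
  apply: (IH _ k) => //.
  have := msize_mderiv ix fN; rewrite df Qx mulrC => /msize_mul_px.
  have : (0 < msize h)%N by rewrite lt0n msize_poly_eq0.
  by lia.
have [psi psiE] := poly_antiderivative charK0 phi.
have : f - horner_alg Q psi = ((f - horner_alg Q psi)@_0)%:MP.
  apply: (mderiv_eq0_const charK0) => i.
  by rewrite mderivB df mderiv_horner_alg psiE hE subrr.
set c := _@_0 => fE; exists (c%:P + psi).
by rewrite rmorphD /= horner_algC -mul_mpolyC mulr1 -fE subrK.
Qed.

(* The degree bounds make the induction in [grad_dot_curl_eq0] terminate. *)
Lemma koszul_mod_zn n a b s N : (msize a <= N)%N -> (msize b <= N)%N ->
  py * a - px * b = z ^+ n * s ->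
  exists k a' b', [/\ a = px * k + z ^+ n * a', b = py * k + z ^+ n * b',
    s = py * a' - px * b', (msize k <= N.-1)%N &
    (msize a' <= N - (0 < n))%N /\ (msize b' <= N - (0 < n))%N].
Proof.
elim: n a b N => [|n IH] a b N aN bN.
  rewrite expr0 mul1r => <-; exists 0, a, b.
  by rewrite !mulr0 !mul1r !add0r msize0 !subn0.
have [a0 [a1 [aE da /(_ _ aN) [a0N a1N]]]] := split_var charK0 iz a.
have [b0 [b1 [bE db /(_ _ bN) [b0N b1N]]]] := split_var charK0 iz b.
move=> E.
(* At z = 0 the relation is a syzygy of [px] and [py], which gives [k0]; the rest, divided by z, is
   the relation for exponent n. *)
have [] := @zfree_eq0 _ charK0 0 (py * a0 - px * b0)
             (py * a1 - px * b1 - z ^+ n * s).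
- exact: mderiv0.
- rewrite mderivB !mderivM da db (mderiv_comm iy iz p) (mderiv_comm ix iz p).
  by rewrite dzp !mderiv0; ring.
- have <- : py * a - px * b - z ^+ n.+1 * s = 0 by rewrite E subrr.
  by rewrite aE bE exprS; ring.
move=> /esym/eqP; rewrite subr_eq0 => /eqP/esym/regular[k0 [b0E a0E]].
move=> /eqP; rewrite subr_eq0 => /eqP/(IH _ _ _ a1N b1N).
move=> [k1 [a' [b' [a1E b1E sE k1N [a'N b'N]]]]].
exists (k0 + z * k1), a', b'; split=> //.
- by rewrite aE a0E a1E exprS; ring.
- by rewrite bE b0E b1E exprS; ring.
- apply: msizeD_le_max; last exact: msize_mulX.
  by apply: msize_mul_px; rewrite -a0E.
by move: a'N b'N; lia.
Qed.

Lemma mderiv_nat i n : (n%:R : A)^`M(i) = 0.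
Proof. by rewrite mderivMn -mpolyC1 mderivC mul0rn. Qed.

Lemma mderiv_zn i n : i != iz -> (z ^+ n)^`M(i) = 0.
Proof.
move=> iNz; case: n => [|n]; first by rewrite expr0 -mpolyC1 mderivC.
by rewrite mderivXn mderivXU (negPf iNz) !mulr0.
Qed.

(** Poincare lemma in the plane: integrate [a] along x, then the remaining error, which depends on y
    only, along y. *)
Lemma closed_zfree_exact a b : a^`M(iz) = 0 -> b^`M(iz) = 0 ->
  b^`M(ix) = a^`M(iy) ->
  exists f, [/\ f^`M(ix) = a, f^`M(iy) = b & f^`M(iz) = 0].
Proof.
move=> az bz ab.
pose f1 := x * mmean ix a.
have f1x : f1^`M(ix) = a by exact: mderiv_mulX_mmean.
have f1z : f1^`M(iz) = 0.
  rewrite mderivM mderivXU mul0r add0r mderiv_mmean // az.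
  by rewrite /mmean msupp0 big_nil mulr0.
pose e := b - f1^`M(iy).
have ex : e^`M(ix) = 0 by rewrite mderivB mderiv_comm f1x ab subrr.
have ez : e^`M(iz) = 0 by rewrite mderivB mderiv_comm f1z mderiv0 bz subrr.
pose f2 := y * mmean iy e.
have f2y : f2^`M(iy) = e by exact: mderiv_mulX_mmean.
have f2_0 i : iy != i -> e^`M(i) = 0 -> f2^`M(i) = 0.
  move=> yi ei; rewrite mderivM mderivXU eq_sym (negPf yi) mul0r add0r.
  by rewrite mderiv_mmean // ei /mmean msupp0 big_nil mulr0.
exists (f1 + f2); split.
- by rewrite mderivD f1x f2_0 // addr0.
- by rewrite mderivD f2y addrC subrK.
by rewrite mderivD f1z f2_0 // addr0.
Qed.

(** Once the field of lower degree is grad f + g grad P, curl (a, b, c) = grad P x grad f = - curl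
    (f grad P), so (a, b, c) + f grad P is closed and hence a gradient. *)
Lemma grad_dot_curl_eq0 r a b c :
  px * (c^`M(iy) - b^`M(iz)) + py * (a^`M(iz) - c^`M(ix))
    + z ^+ r.+1 * (b^`M(ix) - a^`M(iy)) = 0 ->
  exists f g, [/\ a = f^`M(ix) + g * px, b = f^`M(iy) + g * py
    & c = f^`M(iz) + g * z ^+ r.+1].
Proof.
move: {2}(maxn _ _) (leqnn (maxn (msize a) (maxn (msize b) (msize c)))) => N.
elim: N a b c => [|N IH] a b c.
  rewrite !geq_max !leqn0 !msize_poly_eq0 => /and3P[/eqP-> /eqP-> /eqP->] _.
  by exists 0, 0; rewrite !mderiv0 !mul0r addr0.
rewrite !geq_max => /and3P[aN bN cN] E.
have [] := @koszul_mod_zn r.+1 (a^`M(iz) - c^`M(ix)) (b^`M(iz) - c^`M(iy))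
  (a^`M(iy) - b^`M(ix)) N.
- by apply: msizeD_le_max; rewrite ?msizeN; exact: (@msize_mderiv _ _ _ _ N.+1).
- by apply: msizeD_le_max; rewrite ?msizeN; exact: (@msize_mderiv _ _ _ _ N.+1).
- by apply: (lincomb1 (c1 := 1) E); ring.
move=> k [a' [b' [aE bE abE kN [a'N b'N]]]].
(* The curl of [(a, b, c)] is [grad P x (a', b', -k)], and [(a', b', -k)]
   satisfies the same equation in a lower degree. *)
have [||f [g [a'fg b'fg kfg]]] := IH a' b' (- k).
- by rewrite !geq_max msizeN; move: kN a'N b'N; lia.
(* A curl has no divergence; that identity is the equation for (a', b', -k). *)
- have E1 := congr1 (mderiv iz) abE; have E2 := congr1 (mderiv iy) aE.
  have E3 := congr1 (mderiv ix) bE.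
  rewrite !(mderivB, mderivM) (dz_px dzp) (dz_py dzp) in E1.
  rewrite !(mderivB, mderivD, mderivM) mderiv_zn // in E2.
  rewrite !(mderivB, mderivD, mderivM) mderiv_zn // in E3.
  apply: (lincomb3 (c1 := -1) (c2 := 1) (c3 := -1) E1 E2 E3).
  rewrite !mderivN !(@mderiv_comm _ _ iy ix, @mderiv_comm _ _ iz ix,
            @mderiv_comm _ _ iz iy); ring.
(* Subtracting grad f1 cancels the third component; what is left of the other two is free of z. *)
have [f1 f1z] : exists f1, f1^`M(iz) = c + f * z ^+ r.+1.
  by exists (z * mmean iz (c + f * z ^+ r.+1)); exact: mderiv_mulX_mmean.
have f1xz : f1^`M(ix)^`M(iz) = c^`M(ix) + f^`M(ix) * z ^+ r.+1.
  by rewrite mderiv_comm f1z mderivD mderivM mderiv_zn // mulr0 addr0.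
have f1yz : f1^`M(iy)^`M(iz) = c^`M(iy) + f^`M(iy) * z ^+ r.+1.
  by rewrite mderiv_comm f1z mderivD mderivM mderiv_zn // mulr0 addr0.
have [] := @closed_zfree_exact (a - f1^`M(ix) + f * px)
                               (b - f1^`M(iy) + f * py).
- rewrite !(mderivB, mderivD, mderivM) f1xz (dz_px dzp).
  apply: (lincomb3 (c1 := 1) (c2 := z ^+ r.+1) (c3 := - px) aE a'fg kfg).
  ring.
- rewrite !(mderivB, mderivD, mderivM) f1yz (dz_py dzp).
  apply: (lincomb3 (c1 := 1) (c2 := z ^+ r.+1) (c3 := - py) bE b'fg kfg).
  ring.
- rewrite !(mderivB, mderivD, mderivM).
  apply: (lincomb3 (c1 := -1) (c2 := - py) (c3 := px) abE a'fg b'fg).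
  rewrite !(@mderiv_comm _ _ iy ix); ring.
move=> f0 [f0x f0y f0z]; exists (f0 + f1), (- f).
rewrite !mderivD f0x f0y f0z f1z; split; ring.
Qed.

(** * Brackets with p that are polynomials in p *)

Variables (w1 w2 d : nat).
Hypothesis w1_gt0 : (0 < w1)%N.
Hypothesis d_gt0 : (0 < d)%N.
Hypothesis euler : w1%:R * x * px + w2%:R * y * py = d%:R * p.
Hypothesis proper : forall a b, 1 <> a * px + b * py.

(* If phi = d T chi, Euler's formula and regularity replace phi by
   d T chi' + (w1 + w2) chi, which has smaller degree and vanishes only with
   chi. *)
Lemma horner_alg_bracket_eq0 (phi : {poly K}) c :
  horner_alg p phi = c^`M(ix) * py - c^`M(iy) * px -> phi = 0.
Proof.
have [N] := ubnP (size phi).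
elim: N phi c => // N IH phi c; rewrite ltnS => phiN.
have d0 : d%:R != 0 :> K by case: (d) d_gt0 => // e _; exact: natrS_neq0.
move=> phiE.
have [|||chi phi_chi] := @horner_alg_proper_ideal _ _ p px py 0
  (w1%:R * x) (w2%:R * y) 0 (- c^`M(iy)) (c^`M(ix)) 0 _ phi d0.
- by move=> a b e; rewrite mulr0 addr0; exact: proper.
- by rewrite mulr0 addr0 euler.
- by rewrite phiE; ring.
rewrite phi_chi horner_alg_natXM in phiN phiE *.
set cp := horner_alg p chi in phiE.
(* Combining [phiE] with chi(p) times Euler's formula yields a syzygy of [px] and [py]. *)
have [k [ka kb]] : exists k,
    cp * (w1%:R * x) + c^`M(iy) = py * k
    /\ c^`M(ix) - cp * (w2%:R * y) = px * k.
  apply: regular.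
  by apply: (lincomb2 (c1 := cp) (c2 := 1) euler phiE); ring.
(* Subtracting the y-derivative of [kb] from the x-derivative of [ka] and applying Euler's formula
   exhibits psi(p) as a bracket of [k] with p. *)
pose psi := d%:R *: ('X * chi^`()) + (w1 + w2)%:R *: chi.
have psi_coef i : psi`_i = (d * i + w1 + w2)%:R * chi`_i.
  rewrite coefD !coefZ coefXM -addnA [in RHS]natrD mulrDl; congr (_ + _).
  case: i => [|i] /=; first by rewrite muln0 mul0r mulr0.
  by rewrite coef_deriv -[chi`_i.+1 *+ _]mulr_natl mulrA natrM.
have psi0 : psi = 0.
  have [chi0|chi0] := eqVneq chi 0.
    by rewrite /psi chi0 deriv0 mulr0 !scaler0 addr0.
  apply: (IH _ k); last first.
    have E1 := congr1 (mderiv ix) ka; have E2 := congr1 (mderiv iy) kb.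
    rewrite !(mderivB, mderivD, mderivM) !mderivXU !mderiv_nat
            !mderiv_horner_alg /= in E1 E2.
    have -> : horner_alg p psi
      = d%:R * p * horner_alg p chi^`() + (w1 + w2)%:R * cp.
      rewrite /psi rmorphD /= !linearZ /= rmorphM /= horner_algX !scaler_nat.
      by rewrite mulrA.
    apply: (lincomb3 (c1 := 1) (c2 := -1) (c3 := - horner_alg p chi^`())
              E1 E2 euler).
    rewrite natrD !(@mderiv_comm _ _ iy ix) -/cp; ring.
  apply: leq_trans phiN.
  have -> : size (d%:R *: ('X * chi)) = (size chi).+1.
    by rewrite size_scale // mulrC size_mulX.
  apply/leq_sizeP => i /(nth_default 0) chi_i.
  by rewrite psi_coef chi_i mulr0.
suff -> : chi = 0 by rewrite mulr0 scaler0.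
apply/polyP => i; rewrite coef0; have /eqP := psi_coef i.
rewrite psi0 coef0 eq_sym mulf_eq0 => /orP[|/eqP //].
(* Positivity of [w1] makes every factor d i + w1 + w2 nonzero in characteristic zero. *)
have -> : (d * i + w1 + w2 = (d * i + w1.-1 + w2).+1)%N.
  by rewrite -[in LHS](prednK w1_gt0) addnS addSn.
by rewrite (negPf (natrS_neq0 charK0 _)).
Qed.

End RegularPotential.

(** * Euler's formula for weight homogeneous polynomials *)

Section Euler.
Variables (K : fieldType) (w : 'I_3 -> nat) (d : nat).
Local Notation A := {mpoly K[3]}.

Lemma mulX_mderivX (i : 'I_3) m :
  'X_i * ('X_[m] : A)^`M(i) = (m i)%:R *: 'X_[m].
Proof.
rewrite mderivX -scalerAr -mpolyXD.
have [mi|mi] := posnP (m i); first by rewrite mi !scale0r.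
by rewrite addmC submK // lep1mP -lt0n.
Qed.

Lemma weight_homogeneous_euler (P : A) : weight_homogeneous w d P ->
  \sum_i (w i)%:R * ('X_i * P^`M(i)) = d%:R * P.
Proof.
move=> [_ /dhomogP homP]; rewrite [in RHS](mpolyE P) [in LHS](mpolyE P).
under eq_bigr => i _ do rewrite raddf_sum /= !mulr_sumr.
rewrite exchange_big mulr_sumr /=; apply: eq_big_seq => m /homP <-.
rewrite /wdeg natr_sum mulr_suml; apply: eq_bigr => i _.
rewrite mderivZ -scalerAr mulX_mderivX scaler_nat -['X_[m] *+ _]mulr_natl.
by rewrite scalerAr natrM mulrA [_%:R * _]mulrC.
Qed.

End Euler.

(** * Cocycles and coboundaries in degree one *)

Section Cocycles.
Variable K : fieldType.
Hypothesis charK0 : [pchar K] =i pred0.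
Local Notation A := {mpoly K[3]}.
Local Notation x := ('X_ix : A).
Local Notation y := ('X_iy : A).
Local Notation z := ('X_iz : A).
Implicit Types (phi psi gamma : {poly K}) (F : vec3 K).

Variables (r : nat) (p P : A) (w : 'I_3 -> nat) (d : nat).
Local Notation px := (p^`M(ix)).
Local Notation py := (p^`M(iy)).
Local Notation u := (crossv (grad z) (grad P)).
Local Notation e := (euler_field K w).
Hypothesis dzp : p^`M(iz) = 0.
Hypothesis PE : P = p + (r.+2)%:R^-1 *: z ^+ r.+2.
Hypothesis isoP : isolated_singularity P.
Hypothesis properP : ~ exists F : vec3 K, 1 = dotv F (grad P).
Hypothesis w_gt0 : forall i, (0 < w i)%N.
Hypothesis homP : weight_homogeneous w d P.

Let Px : P^`M(ix) = px.
Proof. by rewrite PE potential_dx. Qed.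

Let Py : P^`M(iy) = py.
Proof. by rewrite PE potential_dy. Qed.

Let Pz : P^`M(iz) = z ^+ r.+1.
Proof. by rewrite PE potential_dz. Qed.

Let px0 : px != 0.
Proof.
move: isoP properP; rewrite PE => iP pP.
exact: (px_neq0 charK0 dzp iP pP).
Qed.

Let px_size : (1 < msize px)%N.
Proof.
move: isoP properP; rewrite PE => iP pP.
exact: (msize_px charK0 dzp iP pP).
Qed.

Let reg (a b : A) : px * a = py * b -> exists k : A, a = py * k /\ b = px * k.
Proof.
move: isoP properP; rewrite PE => iP pP.
exact: (px_py_regular charK0 dzp iP pP).
Qed.

Let propJ (a b c : A) : 1 <> a * px + b * py + c * z ^+ r.+1.
Proof.
move: properP; rewrite PE => pP.
exact: (jacobian_proper charK0 dzp pP).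
Qed.

(** The monomial z^(r+2) occurs in [P], because [p] is free of z, so its weighted degree must be
    d. *)
Lemma degreeE : d = (w iz * r.+2)%N.
Proof.
have [_ /dhomogP hom] := homP; rewrite -(hom (U_(iz) *+ r.+2)%MM).
  rewrite /= /wdeg (bigD1 iz) //= mulmnE mnm1E eqxx mul1n big1.
    by rewrite addn0 mulnC.
  by move=> i iz'; rewrite mulmnE mnm1E eq_sym (negPf iz') mul0n.
rewrite mcoeff_msupp PE mcoeffD mcoeffZ mcoeffXn eqxx mulr1.
suff -> : p@_(U_(iz) *+ r.+2)%MM = 0.
  by rewrite add0r invr_eq0 natrS_neq0.
have /eqP := congr1 (mcoeff (U_(iz) *+ r.+1)%MM) dzp.
rewrite mcoeff_mderiv mcoeff0 -[X in X == 0]mulr_natr mulf_eq0.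
rewrite (negPf (natrS_neq0 charK0 _)) orbF => /eqP <-; congr (_@__).
by rewrite mulmS addmC.
Qed.

Lemma d_gt0 : (0 < d)%N.
Proof. by rewrite degreeE muln_gt0 w_gt0. Qed.

Lemma d_neq0 : d%:R != 0 :> K.
Proof. by case: (d) d_gt0 => // n _; exact: natrS_neq0. Qed.

Lemma euler_P : (w ix)%:R * x * px + (w iy)%:R * y * py
  + (w iz)%:R * z * z ^+ r.+1 = d%:R * P.
Proof.
by rewrite -(weight_homogeneous_euler homP) sum3E Px Py Pz !mulrA.
Qed.

(** By [degreeE] the power of z satisfies Euler's formula by itself and can be subtracted from
    [euler_P]. *)
Lemma euler_p : (w ix)%:R * x * px + (w iy)%:R * y * py = d%:R * p.
Proof.
set s := r.+2%:R^-1 *: z ^+ r.+2.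
have E : r.+2%:R * s = z * z ^+ r.+1.
  rewrite -exprS mulr_natl -[LHS]scaler_nat scalerA divff ?natrS_neq0 //.
  by rewrite scale1r.
have dE : d%:R = (w iz)%:R * r.+2%:R :> A by rewrite degreeE natrM.
apply: (lincomb3 (c1 := 1) (c2 := (w iz)%:R)
          (c3 := s) euler_P E dE).
rewrite PE -/s; ring.
Qed.

Lemma grad_zE i : (grad z) i = (i == iz)%:R.
Proof. by rewrite ffunE mderivXU. Qed.

Lemma u_x : u ix = - py.
Proof. by rewrite ffunE /= !grad_zE !ffunE Py /= mul0r mul1r sub0r. Qed.

Lemma u_y : u iy = px.
Proof. by rewrite ffunE /= !grad_zE !ffunE Px /= mul0r mul1r subr0. Qed.

Lemma u_z : u iz = 0.
Proof. by rewrite ffunE /= !grad_zE /= !mul0r subrr. Qed.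

Lemma euler_fieldE i : e i = (w i)%:R * 'X_i.
Proof. by rewrite ffunE scaler_nat mulr_natl. Qed.

Lemma vec3P F (G : vec3 K) : F ix = G ix -> F iy = G iy -> F iz = G iz -> F = G.
Proof.
by move=> Ex Ey Ez; apply/ffunP => i; have [->|[->|->]] := I3P i.
Qed.

Lemma dot_gradP F : dotv F (grad P) = F ix * px + F iy * py + F iz * z ^+ r.+1.
Proof. by rewrite /dotv sum3E !ffunE Px Py Pz. Qed.

Lemma delta1E F i : delta1 z P F i =
  - (z * (dotv F (grad P))^`M(i)) + (z * Div F - F iz) * P^`M(i).
Proof.
rewrite !ffunE; congr (_ + (_ - _) * _).
by rewrite /dotv sum3E !grad_zE /= !mulr0 mulr1 !add0r.
Qed.

Lemma combinationE gamma psi i :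
  (mulv (horner_alg P gamma) u + mulv (horner_alg P psi) e) i
  = horner_alg P gamma * u i + horner_alg P psi * ((w i)%:R * 'X_i).
Proof. by rewrite ffunE [mulv _ u i]ffunE [mulv _ e i]ffunE euler_fieldE. Qed.

Lemma combination_dot gamma psi :
  dotv (mulv (horner_alg P gamma) u + mulv (horner_alg P psi) e) (grad P)
  = d%:R * P * horner_alg P psi.
Proof.
rewrite dot_gradP !combinationE u_x u_y u_z -euler_P; ring.
Qed.

(** The term gamma(P) u is orthogonal to grad P, free of divergence and has no z-component. The
    other term gives z ((w1 + w2) psi(P) + d P psi'(P)) for z Div F - F_z, to be compared with z (d
    psi(P) + d P psi'(P)); they agree if d = w1 + w2 or psi = 0. *)
Lemma combination_cocycle gamma psi : (d <> (w ix + w iy)%N -> psi = 0) ->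
  delta1 z P (mulv (horner_alg P gamma) u + mulv (horner_alg P psi) e) = 0.
Proof.
move=> psi0; apply/ffunP => i; rewrite delta1E combination_dot [RHS]ffunE.
set F := mulv _ u + _.
set Ppsi := horner_alg P psi; set dPpsi := horner_alg P psi^`().
have -> : z * Div F - F iz
    = z * ((w ix)%:R * Ppsi + (w iy)%:R * Ppsi + d%:R * P * dPpsi).
  rewrite /Div sum3E /F !combinationE u_x u_y u_z.
  rewrite !(mderivM, mderivD, mderivN, mderiv_nat, mderivXU, mderiv_horner_alg).
  rewrite Px Py Pz /= -/Ppsi -/dPpsi mderiv0.
  apply: (lincomb1 (c1 := z * dPpsi) euler_P).
  rewrite (mderiv_comm iy ix p); ring.
rewrite !mderivM mderiv_nat mderiv_horner_alg -/Ppsi -/dPpsi.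
have [dE|/eqP dN] := eqVneq d (w ix + w iy)%N; first by rewrite dE natrD; ring.
by rewrite /Ppsi /dPpsi psi0 // deriv0 raddf0; ring.
Qed.

Lemma delta0_x f : delta0 z P f ix
  = - (z * (f^`M(iy) * z ^+ r.+1 - f^`M(iz) * py)).
Proof. by rewrite !ffunE /= Py Pz. Qed.

Lemma delta0_y f : delta0 z P f iy
  = - (z * (f^`M(iz) * px - f^`M(ix) * z ^+ r.+1)).
Proof. by rewrite !ffunE /= Px Pz. Qed.

Lemma delta0_z f : delta0 z P f iz
  = - (z * (f^`M(ix) * py - f^`M(iy) * px)).
Proof. by rewrite !ffunE /= Px Py. Qed.

Lemma z_neq0 : z != 0.
Proof. by rewrite -msize_poly_eq0 msizeX mdeg1. Qed.

Lemma horner_alg_P_split phi :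
  exists f, horner_alg P phi = horner_alg p phi + z * f.
Proof. by rewrite PE exprS scalerAr; exact: horner_alg_congr. Qed.

Lemma dz_horner_alg_p phi : (horner_alg p phi)^`M(iz) = 0.
Proof. by rewrite mderiv_horner_alg dzp mulr0. Qed.

Lemma bracket_p_eq0 phi c :
  horner_alg p phi = c^`M(ix) * py - c^`M(iy) * px -> phi = 0.
Proof.
apply: (@horner_alg_bracket_eq0 _ charK0 p reg (w ix) (w iy) d) => //.
- exact: d_gt0.
- exact: euler_p.
by move=> a b E; apply: (@propJ a b 0); rewrite mul0r addr0.
Qed.

(** Coboundaries are orthogonal to grad P, whereas the combination has product d P psi(P) with
    it. *)
Lemma coboundary_psi_eq0 gamma psi f :
  mulv (horner_alg P gamma) u + mulv (horner_alg P psi) e = delta0 z P f ->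
  horner_alg P psi = 0.
Proof.
move=> E; have := combination_dot gamma psi; rewrite E dot_gradP.
rewrite delta0_x delta0_y delta0_z => dot0.
have dP0 : d%:R * P != 0.
  rewrite mulf_neq0 //; last by case: homP.
  by rewrite -[d%:R](rmorph_nat (@mpolyC 3 K)) mpolyC_eq0 d_neq0.
by apply: (mulfI dP0); rewrite -dot0; ring.
Qed.

(** Once psi(P) = 0, the third component is a syzygy of [px] and [py], and the second then makes
    gamma(P) divisible by z. Hence gamma(p) = 0. *)
Lemma combination_coboundary gamma psi f :
  mulv (horner_alg P gamma) u + mulv (horner_alg P psi) e = delta0 z P f ->
  mulv (horner_alg P gamma) u + mulv (horner_alg P psi) e = 0.
Proof.
move=> E; have psiP0 := coboundary_psi_eq0 E.
have Ei i := congr1 (fun F : vec3 K => F i) E.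
have Ey := Ei iy; have Ez := Ei iz.
rewrite !combinationE psiP0 u_y u_z !(mul0r, addr0, mulr0) /= in Ey Ez.
rewrite delta0_y in Ey; rewrite delta0_z in Ez.
have [|k [fy fx]] := @reg f^`M(iy) f^`M(ix).
  by apply: (mulfI z_neq0); apply: (lincomb1 (c1 := -1) Ez); ring.
have gammaP : horner_alg P gamma = z * (k * z ^+ r.+1 - f^`M(iz)).
  apply: (mulfI px0).
  by apply: (lincomb2 (c1 := 1) (c2 := z * z ^+ r.+1) Ey fx); ring.
have [g gE] := horner_alg_P_split gamma.
have [] := @zfree_eq0 _ charK0 (horner_alg p gamma) 0
             (k * z ^+ r.+1 - f^`M(iz) - g).
- exact: dz_horner_alg_p.
- exact: mderiv0.
- by apply: (lincomb2 (c1 := -1) (c2 := 1) gE gammaP); ring.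
move=> gammap0 _.
(* The bracket criterion with c = 0 says that p is transcendental over K. *)
have -> : gamma = 0.
  by apply: (bracket_p_eq0 (c := 0)); rewrite gammap0 !mderiv0 !mul0r subrr.
by rewrite psiP0 raddf0; apply/ffunP => i; rewrite !ffunE !mul0r addr0.
Qed.

Lemma cocycle_decomposition F : delta1 z P F = 0 -> exists gamma psi f,
  (d <> (w ix + w iy)%N -> psi = 0) /\
  F = mulv (horner_alg P gamma) u + mulv (horner_alg P psi) e + delta0 z P f.
Proof.
move=> F0.
have [h dG hE] : exists2 h, forall i, (dotv F (grad P))^`M(i) = h * P^`M(i)
    & z * Div F - F iz = z * h.
  have zdG i : z * (dotv F (grad P))^`M(i) = (z * Div F - F iz) * P^`M(i).
    have := delta1E F i; rewrite F0 ffunE => /esym/eqP.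
    by rewrite addrC subr_eq0 => /eqP.
  have [h0 [h [hE dh0 _]]] := split_var charK0 iz (z * Div F - F iz).
  have h00 : h0 = 0.
    (* The x-component at z = 0 reads [h0 * px = 0]. *)
    have [] := @zfree_eq0 _ charK0 0 (h0 * px)
                 (h * px - (dotv F (grad P))^`M(ix)).
    - exact: mderiv0.
    - by rewrite mderivM dh0 mderiv_comm dzp mderiv0 mul0r mulr0 addr0.
    - have := zdG ix; rewrite hE Px => E.
      by apply: (lincomb1 (c1 := 1) E); ring.
    by move=> /esym/eqP; rewrite mulf_eq0 (negPf px0) orbF => /eqP.
  rewrite h00 add0r in hE; exists h => // i.
  by apply: (mulfI z_neq0); rewrite zdG hE mulrA.
have [phi GE] := grad_collinear_horner_alg charK0 px0 px_size reg Px Py dG.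
have [psi phiE] : exists psi, phi = d%:R *: ('X * psi).
  apply: (horner_alg_proper_ideal (Q := P) d_neq0 propJ euler_P).
  by rewrite -GE dot_gradP.
rewrite phiE horner_alg_natXM in GE.
set Ppsi := horner_alg P psi in GE; pose dPpsi := horner_alg P psi^`().
have h_psi : h = d%:R * (Ppsi + P * dPpsi).
  apply: (mulIf px0); rewrite -{1}Px -dG GE.
  rewrite !mderivM mderiv_nat mderiv_horner_alg Px -/Ppsi -/dPpsi; ring.
(* The field (a, b, z q) is F - psi(P) e; its third component is divisible by z because of [hE]. *)
have [a aE] : exists a, F ix = a + Ppsi * ((w ix)%:R * x).
  by exists (F ix - Ppsi * ((w ix)%:R * x)); rewrite subrK.
have [b bE] : exists b, F iy = b + Ppsi * ((w iy)%:R * y).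
  by exists (F iy - Ppsi * ((w iy)%:R * y)); rewrite subrK.
have [q qE FzE] : exists2 q, q = Div F - h - Ppsi * (w iz)%:R
    & F iz = z * q + Ppsi * ((w iz)%:R * z).
  exists (Div F - h - Ppsi * (w iz)%:R) => //.
  by apply: (lincomb1 (c1 := -1) hE); ring.
(* The exponent is r + 2 because the third component z q contributes z q z^(r+1). *)
have [] := @koszul_mod_zn _ charK0 p dzp px0 px_size reg r.+2 b (- a) (- q)
  (maxn (msize b) (msize a)).
- exact: leq_maxl.
- by rewrite msizeN leq_maxr.
- move: GE; rewrite dot_gradP aE bE FzE => GE.
  rewrite exprS.
  by apply: (lincomb2 (c1 := 1) (c2 := - Ppsi) GE euler_P); ring.
move=> k [a' [b' [bk ak qk _ _]]].
have [Z ZE [Zx Zy]] : exists2 Z, z ^+ r.+2 = Z & Z^`M(ix) = 0 /\ Z^`M(iy) = 0.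
  by exists (z ^+ r.+2); rewrite ?mderiv_zn.
rewrite ZE in bk ak; rewrite exprS in ZE.
have div_eq : a^`M(ix) + b^`M(iy) + z * q^`M(iz)
    = (d%:R - (w ix)%:R - (w iy)%:R) * Ppsi.
  move: qE; rewrite /Div sum3E aE bE FzE h_psi.
  rewrite !(mderivM, mderivD, mderiv_nat, mderivXU, mderiv_horner_alg).
  rewrite Px Py Pz /= -/Ppsi -/dPpsi => qE.
  by apply: (lincomb2 (c1 := -1) (c2 := - dPpsi) qE euler_P); ring.
(* This is [div_eq] with [a], [b] and [q] replaced by their Koszul expressions. *)
have k_eq : px * k^`M(iy) - py * k^`M(ix)
    + Z * (a'^`M(iy) - b'^`M(ix))
    - z * (py * a'^`M(iz) - px * b'^`M(iz))
    = (d%:R - (w ix)%:R - (w iy)%:R) * Ppsi.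
  have bky := congr1 (mderiv iy) bk; have akx := congr1 (mderiv ix) ak.
  have qkz := congr1 (mderiv iz) qk.
  rewrite !(mderivM, mderivB, mderivD, mderivN) ?Zx ?Zy in bky akx.
  rewrite !(mderivM, mderivB, mderivN) (dz_px dzp) (dz_py dzp) in qkz.
  apply: (lincomb4 (c1 := 1) (c2 := -1) (c3 := 1) (c4 := z)
            div_eq bky akx qkz).
  rewrite (mderiv_comm iy ix p); ring.
have [k0 [k1 [kE dk0 _]]] := split_var charK0 iz k.
have [eta etaE] := horner_alg_P_split psi.
rewrite -/Ppsi in etaE.
have k0_eq : (d%:R - (w ix)%:R - (w iy)%:R) * horner_alg p psi
    = px * k0^`M(iy) - py * k0^`M(ix).
  have ky := congr1 (mderiv iy) kE; have kx := congr1 (mderiv ix) kE.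
  rewrite !(mderivM, mderivD, mderivXU) /= in kx ky.
  apply: (proj1 (@zfree_eq0 _ charK0 _ _ (px * k1^`M(iy) - py * k1^`M(ix)
    + z ^+ r.+1 * (a'^`M(iy) - b'^`M(ix))
    - (py * a'^`M(iz) - px * b'^`M(iz))
    - (d%:R - (w ix)%:R - (w iy)%:R) * eta) _ _ _)).
  - by rewrite mderivM !mderivB !mderiv_nat dz_horner_alg_p; ring.
  - rewrite mderivB !mderivM (dz_px dzp) (dz_py dzp) (mderiv_comm iy iz k0).
    by rewrite (mderiv_comm ix iz k0) dk0 !mderiv0; ring.
  apply: (lincomb4 (c1 := -1) (c2 := - (d%:R - (w ix)%:R - (w iy)%:R))
            (c3 := px) (c4 := - py) k_eq etaE ky kx).
  rewrite -ZE; ring.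
have psi0 : (d%:R - (w ix + w iy)%:R) *: psi = 0.
  apply: (@bracket_p_eq0 _ (- k0)).
  rewrite linearZ /= scalerBl !scaler_nat natrD !mderivN.
  by apply: (lincomb1 (c1 := 1) k0_eq); ring.
have psi0_alg (Q : A) : (d%:R - (w ix)%:R - (w iy)%:R) * horner_alg Q psi = 0.
  have := congr1 (horner_alg Q) psi0.
  rewrite linearZ /= scalerBl !scaler_nat natrD raddf0 => E.
  by apply: (lincomb1 (c1 := 1) E); ring.
have [l [k0y k0x]] : exists l, k0^`M(iy) = py * l /\ k0^`M(ix) = px * l.
  apply: reg.
  by apply: (lincomb2 (c1 := -1) (c2 := 1) k0_eq (psi0_alg p)); ring.
have [gamma k0E] : exists gamma, k0 = horner_alg p gamma.
  apply: (grad_collinear_horner_alg charK0 px0 px_size reg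
            (Q := p) (h := l)) => // i.
  have [->|[->|->]] := I3P i;
    by rewrite ?k0x ?k0y ?dk0 ?dzp ?mulr0 // mulrC.
(* Modulo z, both [k] and gamma(P) reduce to gamma(p). *)
have [c {}kE] : exists c, k = horner_alg P gamma - z * c.
  have [c cE] := horner_alg_P_split gamma; exists (c - k1).
  by rewrite kE k0E cE; ring.
have [|f [g [a'E b'E cE]]] :=
  @grad_dot_curl_eq0 _ charK0 p dzp px0 px_size reg r a' b' c.
  (* The terms in gamma(P) cancel, and up to sign [k_eq] becomes z times grad P . curl (a', b', c) =
     0. *)
  apply: (mulfI z_neq0).
  have ky := congr1 (mderiv iy) kE; have kx := congr1 (mderiv ix) kE.
  rewrite !(mderivM, mderivB, mderivXU, mderiv_horner_alg) Px Py /= in kx ky.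
  apply: (lincomb4 (c1 := -1) (c2 := px) (c3 := - py) (c4 := -1)
            k_eq ky kx (psi0_alg P)).
  rewrite -ZE; ring.
exists gamma, psi, f; split.
  move=> dw; move/eqP: psi0; rewrite scaler_eq0 => /orP[|/eqP //].
  by rewrite subr_eq0 => /eqP/(natr_inj_char0 charK0).
have sumE (G H : vec3 K) i : (G + H) i = G i + H i by rewrite ffunE.
apply: vec3P; rewrite [in RHS]sumE combinationE -/Ppsi.
- rewrite aE delta0_x u_x.
  apply: (lincomb4 (c1 := -1) (c2 := - py) (c3 := - Z)
            (c4 := z * py) ak kE b'E cE).
  rewrite -ZE; ring.
- rewrite bE delta0_y u_y.
  apply: (lincomb4 (c1 := 1) (c2 := px) (c3 := Z)
            (c4 := - z * px) bk kE a'E cE).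
  rewrite -ZE; ring.
rewrite FzE delta0_z u_z.
apply: (lincomb3 (c1 := - z) (c2 := - z * py) (c3 := z * px) qk a'E b'E).
ring.
Qed.

End Cocycles.

(** * The isomorphism onto the first cohomology group *)

Lemma dz_mwiden (K : fieldType) (Pt : {mpoly K[2]}) : (mwiden Pt)^`M(iz) = 0.
Proof.
elim/mpolyind: Pt => [|c m q _ _ IH]; first by rewrite mwiden0 mderiv0.
rewrite mwidenD mwidenZ mwidenX mderivD IH addr0 mderivZ mderivX.
have -> : iz = ord_max by apply/val_inj.
by rewrite mnmwiden_ordmax scale0r scaler0.
Qed.

Theorem theorem6p3 (K : fieldType) (charK0 : [pchar K] =i pred0)
  (r : nat) (Pt : {mpoly K[2]}) (w : 'I_3 -> nat) (d : nat) :
  let lambda : {mpoly K[3]} := 'X_iz in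
  let P : {mpoly K[3]} := mwiden Pt + (r.+2)%:R^-1 *: 'X_iz ^+ r.+2 in
  let u : vec3 K := crossv (grad lambda) (grad P) in
  is_weight w ->
  weight_homogeneous w d P ->
  isolated_singularity P ->
  (exists q : Asing P, q != 0) ->
  (d <> (w ix + w iy)%N ->
     maps_isomorphically_onto_PH1 lambda P (KP_span P u))
  /\
  (d = (w ix + w iy)%N ->
     sum_is_direct (KP_span P u) (KP_span P (euler_field K w))
     /\ maps_isomorphically_onto_PH1 lambda P
          (sum_set (KP_span P u) (KP_span P (euler_field K w)))).
Proof.
move=> lambda P u [w_gt0 _] homP isoP [q q0].
(* Were 1 in the Jacobian ideal, every representative would be too, and the quotient would
   vanish. *)
have properP : ~ exists F : vec3 K, 1 = dotv F (grad P).
  move=> [F F1]; move/eqP: q0; apply; rewrite -[q]reprK; apply/eqP.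
  rewrite -(raddf0 (\pi_(lquot (jacobian_ideal P)))) pi_lquotE subr0.
  apply/boolp.asboolP; exists (mulv (repr q) F).
  rewrite -[LHS]mulr1 F1 /dotv mulr_sumr; apply: eq_bigr => i _.
  by rewrite [mulv _ _ _]ffunE mulrA.
have dzp := dz_mwiden Pt.
pose comb (gamma psi : {poly K}) : vec3 K :=
  mulv (horner_alg P gamma) u + mulv (horner_alg P psi) (euler_field K w).
have comb_cocycle gamma psi : (d <> (w ix + w iy)%N -> psi = 0) ->
    delta1 lambda P (comb gamma psi) = 0.
  exact: (combination_cocycle charK0 dzp erefl).
have comb_coboundary gamma psi f :
    comb gamma psi = delta0 lambda P f -> comb gamma psi = 0.
  exact: (combination_coboundary charK0 dzp erefl isoP properP w_gt0 homP).
have decomp F : delta1 lambda P F = 0 -> exists gamma psi f,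
    (d <> (w ix + w iy)%N -> psi = 0) /\ F = comb gamma psi + delta0 lambda P f.
  exact: (cocycle_decomposition charK0 dzp erefl isoP properP w_gt0 homP).
have combB gamma psi gamma' psi' :
    comb gamma psi - comb gamma' psi' = comb (gamma - gamma') (psi - psi').
  by apply/ffunP => i; rewrite !ffunE !rmorphB; ring.
(* A difference of two combinations is a combination, so injectivity follows from [comb_coboundary];
   surjectivity is [decomp]. *)
have iso (S : vec3 K -> Prop) :
    (forall F, S F <-> exists gamma psi,
       (d <> (w ix + w iy)%N -> psi = 0) /\ F = comb gamma psi) ->
    maps_isomorphically_onto_PH1 lambda P S.
  move=> SE; split=> [F /SE[gamma [psi [psi0 ->]]]|F G|c].
  - exact: comb_cocycle.
  - move=> /SE[gamma [psi [_ FE]]] /SE[gamma' [psi' [_ GE]]] /eqP.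
    rewrite pi_lquotE => /boolp.asboolP[f fE]; apply: val_inj.
    apply/eqP; rewrite -subr_eq0; apply/eqP; rewrite FE GE combB.
    by apply: (comb_coboundary _ _ f); rewrite -combB -FE -GE -fE raddfB.
  have /eqP/decomp[gamma [psi [f [psi0 cE]]]] := valP (repr c).
  have Fker : comb gamma psi \in ker_delta1 lambda P.
    by apply/eqP/comb_cocycle.
  exists (MkZ1 Fker); first by apply/SE; exists gamma, psi.
  rewrite -[c]reprK; apply/eqP; rewrite pi_lquotE; apply/boolp.asboolP.
  by exists (- f); rewrite raddfB /= cE raddfN opprD addrA subrr add0r.
have comb0 gamma : comb gamma 0 = mulv (horner_alg P gamma) u.
  by apply/ffunP => i; rewrite !ffunE raddf0 mul0r addr0.
split=> [dN|dE].
  apply: iso => F; split=> [[gamma ->]|[gamma [psi [/(_ dN)-> ->]]]].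
    by exists gamma, 0; rewrite comb0.
  by exists gamma; rewrite comb0.
split.
  move=> F [gamma FE] [psi FE'].
  (* An element of the intersection gives a zero combination, which is the coboundary of 0, so
     psi(P) = 0. *)
  have combF : comb gamma (- psi) = delta0 lambda P 0.
    rewrite linear0 -[RHS](subrr F) [in X in _ - X]FE' FE.
    by apply/ffunP => i; rewrite !ffunE raddfN mulNr.
  have := coboundary_psi_eq0 charK0 dzp erefl w_gt0 homP combF.
  rewrite raddfN FE' => /eqP; rewrite oppr_eq0 => /eqP->.
  by apply/ffunP => i; rewrite !ffunE mul0r.
apply: iso => F; split.
  move=> [G [H [[gamma ->] [psi ->] ->]]].
  by exists gamma, psi; split.
move=> [gamma [psi [_ ->]]]; exists (mulv (horner_alg P gamma) u).
exists (mulv (horner_alg P psi) (euler_field K w)).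
by split; [exists gamma | exists psi | ].
Qed.
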